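(* Let $G$ be an infinite group and let $\kappa=|G|$. If the cardinal $\kappa$ is regular, then the corona $\nu_\kappa(G)$ of the coarse space $(G,\mathcal{E}_\kappa)$ contains a copy of the space $U_\kappa$, i.e. a subspace homeomorphic to $U_\kappa$, where $U_\kappa=\{p\in\beta\kappa:|P|=\kappa\text{ for each }P\in p\}$ is the space of $\kappa$-uniform ultrafilters on $\kappa$.
   Context: Coarse structures. A coarse structure on a set $X$ is a family $\mathcal{E}$ of subsets of $X\times X$ such that: each $E\in\mathcal{E}$ contains the diagonal $\triangle_X=\{(x,x):x\in X\}$; if $E,E'\in\mathcal{E}$ then $E\circ E'\in\mathcal{E}$ and $E^{-1}\in\mathcal{E}$, where $E\circ E'=\{(x,y):\exists z\ ((x,z)\in E,\ (z,y)\in E')\}$ and $E^{-1}=\{(y,x):(x,y)\in E\}$; if $E\in\mathcal{E}$ and $\triangle_X\subseteq E'\subseteq E$ then $E'\in\mathcal{E}$; for all $x,y\in X$ there is $E\in\mathcal{E}$ with $(x,y)\in E$. The pair $(X,\mathcal{E})$ is called a coarse space (or ballean). A subfamily $\mathcal{E}'\subseteq\mathcal{E}$ is a base for $\mathcal{E}$ if every $E\in\mathcal{E}$ is contained in some $E'\in\mathcal{E}'$. For $x\in X$, $A\subseteq X$, $E\in\mathcal{E}$ put $E[x]=\{y\in X:(x,y)\in E\}$ and $E[A]=\bigcup_{a\in A}E[a]$. A subset $B\subseteq X$ is bounded if $B\subseteq E[a]$ for some $E\in\mathcal{E}$, $a\in X$. Corona. Give $X$ the discrete topology and let $\beta X$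 be its Stone–Čech compactification, viewed as the set of ultrafilters on $X$, with basic open sets $\{q\in\beta X:A\in q\}$, $A\subseteq X$. Let $X^\sharp$ be the set of all $q\in\beta X$ such that each member of $q$ is unbounded in $(X,\mathcal{E})$, with the subspace topology. For $r,q\in X^\sharp$ write $r\,\|\,q$ if there is $E\in\mathcal{E}$ with $E[R]\in q$ for each $R\in r$; this is an equivalence relation on $X^\sharp$. Let $\sim$ be the smallest (by inclusion) equivalence relation on $X^\sharp$ that is closed in $X^\sharp\times X^\sharp$ and contains $\|$. The (Higson's) corona of $(X,\mathcal{E})$ is the quotient space $X^\sharp/\sim$. The balanced coarse structure of a group. For an infinite group $G$ and an infinite cardinal $\kappa\le|G|$, let $[G]^{<\kappa}$ be the family of subsets of $G$ of cardinality $<\kappa$. $\mathcal{E}_\kappa$ is the coarse structure on $G$ with the base consisting of the sets $\{(x,y):y\in FxF\}$, where $F\in[G]^{<\kappa}$ contains the identity of $G$. The corona of $(G,\mathcal{E}_\kappa)$ is denoted by $\nu_\kappa(G)$. The space $U_\kappa$ carries the subspace topology inherited from $\beta\kappa$, where $\kappa$ is regarded as a discrete space. *)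

(* Defs.v *)
From HB Require Import structures.
From mathcomp Require Import all_boot all_classical.
From mathcomp Require Import wochoice topology.

Set Implicit Arguments.
Unset Strict Implicit.
Unset Printing Implicit Defensive.

Local Open Scope classical_set_scope.
Local Open Scope card_scope.
Local Open Scope relation_scope.

(* A cardinal is represented by any type [K] of that cardinality, cardinals
   being compared with [#<=] and [#=]. *)

Definition card_lt T U (A : set T) (B : set U) : Prop :=
  A #<= B /\ ~ (B #<= A).

(* [R] is the non-strict order, so [~~ R x y] means that [y] is strictly below
   [x]: every proper initial segment is smaller than [K], i.e. [(K, R)] is
   isomorphic to the initial ordinal of cardinality [K]. *)
Definition initial_order (K : Type) (R : rel K) : Prop :=
  well_order R /\ forall x, card_lt [set y | ~~ R x y] [set: K].

Definition cofinal_set (K : Type) (R : rel K) (C : set K) : Prop :=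
  forall x, exists2 y, C y & R x y.

(* The cofinality of the initial ordinal of cardinality [K] is [K].  The choice
   of [R] is immaterial, any two initial orders on [K] being isomorphic. *)
Definition regular_cardinal (K : Type) : Prop :=
  infinite_set [set: K] /\
  exists R : rel K, initial_order R /\
    forall C : set K, cofinal_set R C -> C #= [set: K].

Record coarse_structure (X : Type) (E : set (set (X * X))) : Prop := {
  coarse_diag : forall e, E e -> diagonal `<=` e;
  (* the notation [e' \; e] denotes e o e' in the order "first e, then e'" *)
  coarse_comp : forall e e', E e -> E e' -> E (e' \; e);
  coarse_inv : forall e, E e -> E (e^-1);
  coarse_sub : forall e e', E e -> diagonal `<=` e' -> e' `<=` e -> E e';
  coarse_connected : forall x y, exists2 e, E e & e (x, y) }.

(* The coarse structure with base [B], for [B] a family of supersets of the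
   diagonal. *)
Definition coarse_of_base (X : Type) (B : set (set (X * X))) :
    set (set (X * X)) :=
  [set e | diagonal `<=` e /\ exists2 b, B b & e `<=` b].

(* E[A] *)
Definition coarse_nbhd (X : Type) (e : set (X * X)) (A : set X) : set X :=
  \bigcup_(a in A) [set y | e (a, y)].

Definition coarse_bounded (X : Type) (E : set (set (X * X))) (B : set X) :
    Prop :=
  exists e a, E e /\ B `<=` [set y | e (a, y)].

(* The Stone-Cech compactification of the discrete space [X], as the space of
   ultrafilters on [X]. *)
Record beta (X : Type) := Beta {
  ultra :> set X -> Prop;
  ultraP : UltraFilter ultra }.

HB.instance Definition _ (X : Type) := gen_eqMixin (beta X).
HB.instance Definition _ (X : Type) := gen_choiceMixin (beta X).

Section BetaTopology.
Variable X : Type.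

Definition beta_basic (A : set X) : set (beta X) := [set q : beta X | q A].

Let beta_basic_cover : \bigcup_(A in [set: set X]) beta_basic A = setT.
Proof.
rewrite -subTset => q _; exists setT => //; rewrite /beta_basic/=.
by have [? _] := ultraP q; exact: filterT.
Qed.

Let beta_basic_join (A B : set X) (q : beta X) :
  setT A -> setT B -> beta_basic A q -> beta_basic B q ->
  exists C, [/\ setT C, beta_basic C q &
                beta_basic C `<=` beta_basic A `&` beta_basic B].
Proof.
move=> _ _ qA qB; exists (A `&` B); split => // [|p pAB].
  by rewrite /beta_basic/=; have [? _] := ultraP q; exact: filterI.
by have [? _] := ultraP p; split; apply: filterS pAB => x [].
Qed.

HB.instance Definition _ :=
  isBaseTopological.Build (beta X) beta_basic_cover beta_basic_join.

End BetaTopology.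

(* Subsets of a topological space used as types carry the subspace topology. *)

Definition sharp (X : Type) (E : set (set (X * X))) : set (beta X) :=
  [set q : beta X | forall A, q A -> ~ coarse_bounded E A].

Definition parallel (X : Type) (E : set (set (X * X))) :
    set (sharp E * sharp E) :=
  [set rq : sharp E * sharp E | exists2 e, E e &
    forall A, \val rq.1 A -> \val rq.2 (coarse_nbhd e A)].
Arguments parallel {X} E _.

Record equivalence_set (T : Type) (S : set (T * T)) : Prop := {
  equivalence_refl : forall x, S (x, x);
  equivalence_sym : forall x y, S (x, y) -> S (y, x);
  equivalence_trans : forall x y z, S (x, y) -> S (y, z) -> S (x, z) }.

Definition corona_sim (X : Type) (E : set (set (X * X))) :
    set (sharp E * sharp E) :=
  smallest [set S | equivalence_set S /\ closed S] (parallel E).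
Arguments corona_sim {X} E _.

Section Corona.
Variables (X : Type) (E : set (set (X * X))).

Definition corona_rel : rel (sharp E) := fun p q => `[< corona_sim E (p, q) >].

Lemma corona_rel_refl : reflexive corona_rel.
Proof.
by move=> p; apply/asboolP => S [[eqS _] _]; exact: equivalence_refl.
Qed.

Lemma corona_rel_sym : symmetric corona_rel.
Proof.
by move=> p q; apply/asboolP/asboolP => h S HS; have [[eqS _] _] := HS;
  exact: (equivalence_sym eqS (h _ HS)).
Qed.

Lemma corona_rel_trans : transitive corona_rel.
Proof.
move=> q p r /asboolP pq /asboolP qr; apply/asboolP => S HS.
have [[eqS _] _] := HS.
exact: (equivalence_trans eqS (pq _ HS) (qr _ HS)).
Qed.

Canonical corona_equiv_rel :=
  EquivRel corona_rel corona_rel_refl corona_rel_sym corona_rel_trans.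

Definition corona : topologicalType :=
  quotient_topology {eq_quot corona_rel}%qT.

End Corona.

Definition balanced_entourage (G : groupType) (F : set G) : set (G * G) :=
  [set xy | exists f g, [/\ F f, F g & xy.2 = (f * xy.1 * g)%g]].

Definition balanced (K : Type) (G : groupType) : set (set (G * G)) :=
  coarse_of_base
    [set balanced_entourage F | F in [set F | card_lt F [set: K] /\ F 1%g]].
Arguments balanced K G _ : clear implicits.

Section BalancedCoarse.
Variables (K : Type) (G : groupType).
Hypotheses (cardK : [set: K] #= [set: G]) (regK : regular_cardinal K).

Let card_ltW (T U : Type) (A : set T) (B : set U) :
  A #<= B -> card_lt B [set: K] -> card_lt A [set: K].
Proof.
move=> AB [BK nKB]; split; first exact: card_le_trans BK.
by move=> KA; apply: nKB; exact: card_le_trans AB.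
Qed.

Lemma card_lt_image2 (F F' : set G) (op : G -> G -> G) :
  card_lt F [set: K] -> card_lt F' [set: K] ->
  card_lt [set op f f' | f in F & f' in F'] [set: K].
Proof.
move=> ltF ltF'; have [infK [R [[woR _] cofR]]] := regK.
have bndP (C : set K) : card_lt C [set: K] ->
    exists x, forall y, C y -> ~ R x y.
  move=> [_ nKC]; apply: contrapT => nb; apply: nKC.
  suff /cofR : cofinal_set R C by rewrite card_eq_le => /andP[].
  move=> x; apply: contrapT => h; apply: nb; exists x => y Cy Rxy.
  by apply: h; exists y.
split.
  apply: (@card_le_trans _ _ _ [set: G]); first exact: subset_card_le.
  by move: cardK; rewrite card_eq_le => /andP[].
move=> /card_leP[h].
pose phi k := set_val (h (exist _ k (mem_set I))).
have phiFF k : [set op f f' | f in F & f' in F'] (phi k) by exact: set_valP.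
have phi_inj : injective phi.
  move=> x y /val_inj /(@inj _ _ _ h) e.
  by have := congr1 val (e (mem_set I) (mem_set I)).
have bF f : F f -> exists x, forall y, (exists2 f', F' f' & phi y = op f f') ->
    ~ R x y.
  move=> Ff; apply: bndP; apply: card_ltW ltF'.
  apply: (@card_le_trans _ _ _
    (phi @` [set y | exists2 f', F' f' & phi y = op f f'])).
    have := @inj_card_eq _ _ [set y | exists2 f', F' f' & phi y = op f f']
      phi (in2W phi_inj).
    by rewrite card_eq_le => /andP[].
  apply: card_le_trans (card_image_le (op f) F').
  by apply: subset_card_le => _ [y [f' Ff' ->] <-]; exists f'.
have /choice[b bP] : forall f, exists x, F f ->
    forall y, (exists2 f', F' f' & phi y = op f f') -> ~ R x y.
  move=> f; have [/bF[x hx]|nF] := pselect (F f); first by exists x.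
  by have [x _] := infinite_setN0 infK; exists x.
have /bndP[m mP] : card_lt (b @` F) [set: K].
  by apply: card_ltW ltF; exact: card_image_le.
have [f Ff [f' Ff' fE]] := phiFF m.
have nbm : ~ R (b f) m by apply: bP => //; exists f'.
have nmb : ~ R m (b f) by apply: mP; exists f.
pose A : {pred K} := fun z => `[< z = m \/ z = b f >].
have [|z [[/asboolP zA zmin] _]] := woR A.
  by exists m; apply/asboolP; left.
by case: zA => zE; [apply: nmb|apply: nbm]; rewrite -zE; apply: zmin;
  apply/asboolP; [right|left].
Qed.

Lemma balanced_coarse_structure : coarse_structure (balanced K G).
Proof.
have inf : [set: nat] #<= [set: K] by apply/infiniteP; case: regK.
have small1 (T : Type) (F : set T) : finite_set F -> card_lt F [set: K].
  move=> finF; split.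
    by apply: card_le_trans inf; exact: finite_set_countable.
  by move=> KF; case: regK => + _; apply; exact: card_le_finite KF finF.
have diagF (F : set G) : F 1%g -> diagonal `<=` balanced_entourage F.
  move=> F1 [x y]; rewrite /diagonal/= => ->; exists 1%g, 1%g.
  by split=> //=; rewrite mul1g mulg1.
have small2 (F F' : set G) : card_lt F [set: K] -> F 1%g ->
    card_lt F' [set: K] -> F' 1%g -> exists H : set G,
    [/\ card_lt H [set: K], H 1%g & forall f f', F f -> F' f' ->
        H (f * f')%g /\ H (f' * f)%g].
  move=> lF F1 lF' F1'.
  have l1 := card_lt_image2 (fun x y => (x * y)%g) lF lF'.
  have l2 := card_lt_image2 (fun x y => (x * y)%g) lF' lF.
  exists [set (x * y)%g | x in [set (x * y)%g | x in F & y in F'] &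
                          y in [set (x * y)%g | x in F' & y in F]].
  have m (H H' : set G) (h h' k : G) : H h -> H' h' -> k = (h * h')%g ->
      [set (x * y)%g | x in H & y in H'] k.
    by move=> Hh Hh' ->; exists h => //; exists h'.
  have m1 (H H' : set G) : H 1%g -> H' 1%g ->
      [set (x * y)%g | x in H & y in H'] 1%g.
    by move=> Hh Hh'; apply: (m _ _ 1%g 1%g) => //; rewrite mulg1.
  split; [exact: card_lt_image2|exact: m1 (m1 _ _ F1 F1') (m1 _ _ F1' F1)|].
  move=> f f' Ff Ff'; split.
    by apply: (m _ _ (f * f')%g 1%g);
      [exact: m Ff Ff' (erefl _)|exact: m1|rewrite mulg1].
  by apply: (m _ _ 1%g (f' * f)%g);
    [exact: m1|exact: m Ff' Ff (erefl _)|rewrite mul1g].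
split.
- by move=> e [].
- move=> e e' [de [_ [F [lF F1] <-] eF]] [de' [_ [F' [lF' F1'] <-] eF']].
  have [H [lH H1 HM]] := small2 _ _ lF F1 lF' F1'.
  split.
    by move=> [x y] xy; exists x; [exact: de|exact: de'].
  exists (balanced_entourage H); first by exists H.
  move=> [x y] /= [z /eF [f [g [/= Ff Fg ->]]] /eF' [f' [g' [/= Ff' Fg' ->]]]].
  exists (f' * f)%g, (g * g')%g; split; [by have [] := HM _ _ Ff Ff'|
    by have [] := HM _ _ Fg Fg'|by rewrite /= !mulgA].
- move=> e [de [_ [F [lF F1] <-] eF]]; split.
    by move=> [x y]; rewrite /diagonal/= => ->; exact: de.
  exists (balanced_entourage ((fun x : G => x^-1)%g @` F)).
    exists ((fun x : G => x^-1)%g @` F) => //; split.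
      by apply: card_ltW lF; exact: card_image_le.
    by exists 1%g => //; rewrite invg1.
  move=> [x y] /= /eF [f [g [/= Ff Fg ->]]].
  exists (f^-1)%g, (g^-1)%g; split; [by exists f|by exists g|].
  by rewrite /= !mulgA mulVg mul1g -mulgA mulgV mulg1.
- move=> e e' [_ [_ [F lF <-] eF]] de' e'e; split => //.
  by exists (balanced_entourage F); [exists F|exact: subset_trans eF].
- move=> x y; exists (balanced_entourage [set 1; x^-1 * y]%g); last first.
    exists 1%g, (x^-1 * y)%g; split; [by left|by right|].
    by rewrite /= mul1g mulgA mulgV mul1g.
  split; first by apply: diagF; left.
  exists (balanced_entourage [set 1; x^-1 * y]%g) => //.
  exists [set 1; x^-1 * y]%g => //; split; last by left.
  exact: small1.
Qed.

End BalancedCoarse.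

Definition uniform_ultra (K : Type) : set (beta K) :=
  [set p : beta K | forall P, p P -> P #= [set: K]].
Arguments uniform_ultra K _ : clear implicits.

Definition homeomorphic (S T : topologicalType) : Prop :=
  exists (f : S -> T) (g : T -> S),
    [/\ continuous f, continuous g, cancel f g & cancel g f].

Definition contains_copy (T S : topologicalType) : Prop :=
  exists A : set T, homeomorphic A S.

(* Main.v *)
Require Import Defs.
From mathcomp Require Import all_boot all_classical topology wochoice.
From mathcomp Require Import zify.

(* Let V be a base of a uniformity on the coarse space X such that, for every
   entourage e and every index N, e-related points outside of a bounded set are
   V N-close.  Being V-proximal is then a closed equivalence relation on the
   unbounded ultrafilters that contains parallelism, hence also the relation
   defining the corona.  If s : K -> X is V-discrete and pulls bounded sets back
   to sets smaller than K, pushing ultrafilters along s embeds U_K into the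
   corona, because the ultrafilters that are V-far from s(K \ A) form a
   saturated open set, which contains the push of p exactly when A is in p.

   For G countable, exhaust G by finite sets F_n with F_n F_n F_n inside
   F_{n+1}, let r x be the least n with x in F_n, and call x, y close when
   r x / r y is near 1: two-sided multiplication by a finite set changes r by at
   most 1 far away.  A sequence along which r more than doubles is discrete.  For G
   uncountable, enumerate G along the initial ordinal K and let f x be the least
   a such that x is in the submonoid H_a generated by the elements before a;
   these are small by regularity, so that f is invariant under two-sided
   multiplication by a small set outside of a bounded set, and a section of f
   over its range, which is cofinal, is discrete. *)

Set Implicit Arguments.
Unset Strict Implicit.
Unset Printing Implicit Defensive.

Local Open Scope classical_set_scope.
Local Open Scope card_scope.

(** * Ultrafilters on a discrete space *)

Lemma ultraI (X : Type) (p : beta X) A B : p A -> p B -> p (A `&` B).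
Proof. by have [? _] := ultraP p; exact: filterI. Qed.

Lemma ultraS (X : Type) (p : beta X) A B : A `<=` B -> p A -> p B.
Proof. by have [? _] := ultraP p; exact: filterS. Qed.

Lemma ultra_ex (X : Type) (p : beta X) A : p A -> exists x, A x.
Proof. by have [? _] := ultraP p; exact: filter_ex. Qed.

Lemma ultraVC (X : Type) (p : beta X) A : p A \/ p (~` A).
Proof. exact: in_ultra_setVsetC (ultraP p). Qed.

(** By maximality: a member of [q] missing from [p] would have its complement in [p], hence in
    [q]. *)
Lemma beta_eq (X : Type) (p q : beta X) : (forall A, p A -> q A) -> p = q.
Proof.
move=> pq; have {}pq : ultra p = ultra q.
  apply/funext => A; apply/propext; split; first exact: pq.
  have [//|/pq qnA qA] := ultraVC p A.
  by have [x []] := ultra_ex (ultraI qA qnA).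
case: p q pq => [p pU] [q qU] /= pq.
by case: _ / pq qU => qU; rewrite (Prop_irrelevance pU qU).
Qed.

Lemma ultra_fmap (X Y : Type) (f : X -> Y) (p : beta X) :
  UltraFilter [set A | p (f @^-1` A)].
Proof.
have [pF _] := ultraP p.
split; first exact: (@fmap_proper_filter _ _ f p pF).
move=> G GF sG; rewrite predeqE => A; split; last exact: sG.
move=> GA; have [//|pnA] := ultraVC p (f @^-1` A).
have /filter_ex[x []] // : G (A `&` ~` A) by apply: filterI => //; exact: sG.
Qed.

Definition beta_map (X Y : Type) (f : X -> Y) (p : beta X) : beta Y :=
  Beta (ultra_fmap f p).

Lemma beta_map_continuous (X Y : Type) (f : X -> Y) :
  continuous (beta_map f).
Proof.
apply/continuousP => _ [D _ <-].
exists [set f @^-1` A | A in D] => //.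
by rewrite bigcup_image preimage_bigcup.
Qed.

(** * Embedding uniform ultrafilters into a corona *)

Section Separation.
Variables (X : Type) (E : set (set (X * X))) (K : Type).
Variables (V : nat -> X -> X -> Prop) (s : K -> X).
Hypothesis V_refl : forall N x, V N x x.
Hypothesis V_sym : forall N x y, V N x y -> V N y x.
Hypothesis V_split : forall N, exists M, forall x y z,
  V M x y -> V M y z -> V N x z.
Hypothesis V_slow : forall e N, E e ->
  exists2 B, coarse_bounded E B & forall x y, ~ B x -> e (x, y) -> V N x y.
Hypothesis s_proper : forall B, coarse_bounded E B ->
  card_lt (s @^-1` B) [set: K].
Hypothesis s_discrete : forall a b, V 0 (s a) (s b) -> a = b.

Definition proximal : set (sharp E * sharp E) :=
  [set pq : sharp E * sharp E | forall P Q N, \val pq.1 P -> \val pq.2 Q ->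
    exists x y, [/\ P x, Q y & V N x y]].

Lemma proximal_equivalence : equivalence_set proximal.
Proof.
split.
- by move=> p P Q N /= pP pQ; have [x [Px Qx]] := ultra_ex (ultraI pP pQ);
    exists x, x.
- move=> p q pq P Q N /= qP pQ.
  have [x [y [Qx Py Vxy]]] := pq Q P N pQ qP.
  by exists y, x; split=> //; exact: V_sym.
- move=> p q r pq qr P Q N /= pP rQ.
  have [M MN] := V_split N.
  (* If [q] contains this neighbourhood of [P], two [M]-steps lead from [P] to [Q]; otherwise its
     complement is a member of [q] that is [M]-far from [P], against [pq]. *)
  pose W := [set y | exists2 x, P x & V M x y].
  have [qW|qnW] := ultraVC (\val q) W.
    have [y [z [[x Px Vxy] Qz Vyz]]] := qr W Q M qW rQ.
    by exists x, z; split=> //; exact: MN Vxy Vyz.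
  have [x [y [Px nWy Vxy]]] := pq P (~` W) M pP qnW.
  by exfalso; apply: nWy; exists x.
Qed.

Lemma open_sharp_basic (P : set X) : open [set q : sharp E | \val q P].
Proof.
exists (beta_basic P) => //.
by exists [set P] => //; rewrite bigcup_set1.
Qed.

(** Sets [P] and [Q] that violate proximality at some [N] do so for all ultrafilters containing
    them, so the complement is open. *)
Lemma proximal_closed : closed proximal.
Proof.
rewrite -openC openE => -[p q] /= /existsNP[P] /existsNP[Q] /existsNP[N].
move=> /not_implyP[pP] /not_implyP[qQ] npq.
exists ([set q : sharp E | \val q P], [set q : sharp E | \val q Q]).
  by split; apply: open_nbhs_nbhs; split=> //; exact: open_sharp_basic.
by move=> [p' q'] /= [p'P q'Q] /(_ P Q N p'P q'Q).
Qed.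

(** Members of [p] remain in [p] once the bounded set [B] is removed, and outside of [B] the
    entourage moves points only [N]-close. *)
Lemma parallel_proximal : parallel E `<=` proximal.
Proof.
move=> [p q] /= [e Ee pq] P Q N /= pP qQ.
have [B bB BV] := V_slow N Ee.
have [pB|pnB] := ultraVC (\val p) B.
  by have /set_mem/(_ _ pB) := valP p.
have [y [[x [Px nBx] exy] Qy]] := ultra_ex (ultraI (pq _ (ultraI pP pnB)) qQ).
by exists x, y; split=> //; exact: BV.
Qed.

Lemma corona_sim_proximal : corona_sim E `<=` proximal.
Proof.
apply: smallest_sub; last exact: parallel_proximal.
by split; [exact: proximal_equivalence|exact: proximal_closed].
Qed.

Definition apart (A : set K) : set (sharp E) :=
  [set q : sharp E | exists Q N,
    \val q Q /\ forall b y, ~ A b -> Q y -> ~ V N (s b) y].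

Lemma apart_open A : open (apart A).
Proof.
rewrite openE => q [Q [N [qQ QN]]].
apply: (@filterS _ _ _ [set q : sharp E | \val q Q]).
  by move=> q' q'Q; exists Q, N.
by apply: open_nbhs_nbhs; split=> //; exact: open_sharp_basic.
Qed.

(** If [q] contained the [M]-neighbourhood of the image of the complement of [A], proximality would
    bring a point of [P] within two [M]-steps of that image. So the complement of this neighbourhood
    witnesses apartness of [q]. *)
Lemma apart_saturated A p q : corona_sim E (p, q) -> apart A p -> apart A q.
Proof.
move=> /corona_sim_proximal pq [P [N [pP PN]]].
have [M MN] := V_split N.
pose W := [set y | exists2 b, ~ A b & V M (s b) y].
have [qW|qnW] := ultraVC (\val q) W.
  have [x [y [Px [b nAb Vby] Vxy]]] := pq P W M pP qW.
  by exfalso; apply: (PN b x nAb Px); apply: (MN _ y) => //; exact: V_sym.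
by exists (~` W), M; split=> // b y nAb nWy Vby; apply: nWy; exists b.
Qed.

Lemma push_sharp p : uniform_ultra K p -> sharp E (beta_map s p).
Proof.
move=> up P pP /s_proper[_]; apply.
by have := up _ pP; rewrite card_eq_le => /andP[].
Qed.

Definition push_uniform (p : uniform_ultra K) : sharp E :=
  SigSub (mem_set (push_sharp (set_mem (valP p)))).

Lemma push_uniformE p P : \val (push_uniform p) P = \val p (s @^-1` P).
Proof. by []. Qed.

Lemma push_uniform_continuous : continuous push_uniform.
Proof.
apply: (@continuous_comp_initial _ _ _ set_val) => p.
apply: (@continuous_comp _ _ _
  (set_val : uniform_ultra K -> beta K) (beta_map s)).
  exact: initial_continuous.
exact: beta_map_continuous.
Qed.

(** This recovers [p] from the class of its push, which yields both injectivity and continuity of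
    the inverse. From right to left, discreteness of [s] separates the images of [A] and of its
    complement at index 0. *)
Lemma apart_push A p : apart A (push_uniform p) <-> \val p A.
Proof.
split=> [[Q [N [pQ QN]]]|pA].
  have [//|pnA] := ultraVC (\val p) A.
  by have [a [Qa nAa]] := ultra_ex (ultraI (pQ : \val p (s @^-1` Q)) pnA);
    case: (QN a (s a)).
exists (s @` A), 0; split.
  by rewrite push_uniformE; apply: ultraS pA => a Aa; exists a.
by move=> b _ nAb [a Aa <-] /s_discrete ba; apply: nAb; rewrite ba.
Qed.

Definition to_corona (p : uniform_ultra K) : corona E :=
  \pi_(corona E)%qT (push_uniform p).

Lemma corona_pi_eq (x y : sharp E) :
  \pi_(corona E)%qT x = \pi_(corona E)%qT y -> corona_sim E (x, y).
Proof. by move=> /(@eqmodP _ (corona_equiv_rel E)) /asboolP. Qed.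

Lemma to_corona_inj : injective to_corona.
Proof.
move=> p q /corona_pi_eq pq; apply/val_inj/beta_eq => A pA.
by apply/apart_push/(apart_saturated pq)/apart_push.
Qed.

Lemma to_corona_continuous : continuous to_corona.
Proof.
move=> p; apply: continuous_comp; first exact: push_uniform_continuous.
exact: pi_continuous.
Qed.

Lemma contains_copy_uniform : contains_copy (corona E) (uniform_ultra K).
Proof.
pose Y : set (corona E) := range to_corona.
have YP (z : Y) : exists p, to_corona p = \val z.
  by have [p _ pz] := set_mem (valP z); exists p.
have toY p : to_corona p \in Y by apply/mem_set; exists p.
have [f fP] := choice YP.
exists Y, f, (fun p => SigSub (toY p)); split.
- apply/continuousP => _ [_ [D _ <-] <-].
  (* By saturation the representative chosen by [repr] does not matter, so [O A] pulls back to the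
     open set [apart A]. *)
  pose O A : set (corona E) := [set z | apart A (repr z)].
  have OE A x : O A (\pi_(corona E)%qT x) <-> apart A x.
    by split; apply: apart_saturated; apply: corona_pi_eq; rewrite reprK.
  exists (\bigcup_(A in D) O A).
    apply: bigcup_open => A _; rewrite /open/= /quotient_open.
    suff -> : \pi_(corona E)%qT @^-1` O A = apart A by exact: apart_open.
    by apply/predeqP => x; exact: OE.
  apply/predeqP => z; split=> -[A DA zA]; exists A => //.
    by apply/apart_push/OE; rewrite -/(to_corona _) fP.
  by move: zA => /apart_push/OE; rewrite -/(to_corona _) fP.
- apply: continuous_comp_initial; exact: to_corona_continuous.
- by move=> z; apply/val_inj; rewrite /= fP.
- by move=> p; apply: to_corona_inj; rewrite fP.
Qed.

End Separation.

(** * Order axioms derived from unique minima *)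

Section WellOrder.
Variables (K : Type) (R : rel K).
Hypothesis woR : well_order R.

Lemma well_order_least (P : set K) : P !=set0 ->
  exists2 z, P z & forall x, P x -> R z x.
Proof.
move=> [x Px].
have [|z [[/asboolP Pz zmin] _]] := woR (A := fun x => `[< P x >]).
  by exists x; apply/asboolP.
by exists z => // y Py; apply: zmin; apply/asboolP.
Qed.

Lemma well_order_total x y : R x y \/ R y x.
Proof.
have [|z [->|->] zR] := @well_order_least [set x; y]; first by exists x; left.
  by left; apply: zR; right.
by right; apply: zR; left.
Qed.

(** Both elements would be minima of the pair, and [well_order] makes minima unique. *)
Lemma well_order_anti x y : R x y -> R y x -> x = y.
Proof.
have Rxx z : R z z by have [] := well_order_total z z.
move=> Rxy Ryx; have [|z [_ zU]] := woR (A := fun z => `[< z = x \/ z = y >]).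
  by exists x; apply/asboolP; left.
have <- : z = x.
  by apply: zU; split=> [|t /asboolP[]->//]; apply/asboolP; left.
by apply: zU; split=> [|t /asboolP[]->//]; apply/asboolP; right.
Qed.

(** If the least of the three is [y] or [z], antisymmetry identifies it with the element before
    it. *)
Lemma well_order_trans x y z : R x y -> R y z -> R x z.
Proof.
move=> Rxy Ryz.
have [|m mP mR] := @well_order_least [set x; y; z].
  by exists x; left; left.
have [Rmx Rmy Rmz] : [/\ R m x, R m y & R m z].
  by split; apply: mR; [left; left|left; right|right].
case: mP => [[]|] /= mE; rewrite mE in Rmx Rmy Rmz => //.
  by rewrite (well_order_anti Rxy Rmx).
by rewrite -(well_order_anti Ryz Rmy).
Qed.

Lemma well_order_nle x y : ~~ R x y -> R y x.
Proof. by have [->|] := well_order_total x y. Qed.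

End WellOrder.

(** * Sets smaller than a regular cardinal *)

Lemma card_le_injective (T U : Type) (A : set U) : [set: T] #<= A ->
  exists2 j : T -> U, injective j & forall t, A (j t).
Proof.
move=> /card_leP[h]; pose toT t : [set: T] := exist _ t (mem_set Logic.I).
exists (fun t => set_val (h (toT t))).
  move=> x y /val_inj e.
  have hI t : t \in [set: [set: T]] by exact: mem_set.
  by have := congr1 val (@inj _ _ _ h _ _ (hI _) (hI _) e).
by move=> t; exact: set_valP.
Qed.

Section SmallSets.
Variables (K : Type).

Lemma card_lt_le (T U : Type) (A : set T) (B : set U) :
  A #<= B -> card_lt B [set: K] -> card_lt A [set: K].
Proof.
move=> AB [BK nKB]; split; first exact: card_le_trans BK.
by move=> KA; apply: nKB; exact: card_le_trans AB.
Qed.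

Lemma card_lt_inj (T U : Type) (f : T -> U) (A : set T) :
  injective f -> card_lt (f @` A) [set: K] -> card_lt A [set: K].
Proof.
move=> f_inj; apply: card_lt_le.
by have := inj_card_eq (A := A) (in2W f_inj); rewrite card_eq_le => /andP[].
Qed.

Hypothesis regK : regular_cardinal K.

Lemma card_lt_finite (T : Type) (A : set T) :
  finite_set A -> card_lt A [set: K].
Proof.
have [infK _] := regK; move=> finA; split.
  apply: card_le_trans (proj1 (infiniteP _) infK).
  exact: finite_set_countable.
by move=> KA; apply: infK; exact: card_le_finite KA finA.
Qed.

(** Turns smallness into strict boundedness: a small set is not cofinal by regularity, and a
    strictly bounded set lies in a proper initial segment. *)
Lemma regular_initial_order : exists2 R : rel K, well_order R &
  [/\ forall C : set K, card_lt C [set: K] <->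
        exists x, forall y, C y -> ~~ R x y
    & forall C, cofinal_set R C -> C #= [set: K]].
Proof.
have [_ [R [[woR initR] cofR]]] := regK; exists R => //; split=> // C; split.
  move=> [_ nKC]; apply: contrapT => nb; apply: nKC.
  suff /cofR : cofinal_set R C by rewrite card_eq_le => /andP[].
  move=> x; apply: contrapT => h; apply: nb; exists x => y Cy.
  by apply/negP => Rxy; apply: h; exists y.
move=> [x xC]; apply: card_lt_le (initR x); exact: subset_card_le.
Qed.

Lemma card_lt_bigcup (I T : Type) (D : set I) (A : I -> set T) :
  [set: T] #<= [set: K] -> card_lt D [set: K] ->
  (forall i, D i -> card_lt (A i) [set: K]) ->
  card_lt (\bigcup_(i in D) A i) [set: K].
Proof.
move=> TK ltD ltA; have [R woR [ltR _]] := regular_initial_order.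
have [j j_inj _] := card_le_injective TK.
(* Each [A i], moved into [K], gets a bound [b i], arbitrary for [i] outside [D]. These bounds form
   a small set, which has a bound [m] in turn. *)
have /choice[b bP] : forall i, exists x, D i ->
    forall y, (j @` A i) y -> ~~ R x y.
  move=> i; have [Di|nDi] := pselect (D i); last first.
    by have [k _] := infinite_setN0 (proj1 regK); exists k.
  have /ltR[x xP] : card_lt (j @` A i) [set: K].
    by apply: card_lt_le (ltA i Di); exact: card_image_le.
  by exists x.
have /ltR[m mP] : card_lt (b @` D) [set: K].
  by apply: card_lt_le ltD; exact: card_image_le.
apply: (card_lt_inj j_inj); apply/ltR; exists m => _ [t [i Di Ait] <-].
have Rbm : R (b i) m by apply: (well_order_nle woR); apply: mP; exists i.
apply/negP => Rmt; have /negP := bP i Di (j t) (imageP j Ait); apply.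
exact: (well_order_trans woR Rbm Rmt).
Qed.

Lemma card_ltU (T : Type) (A B : set T) : [set: T] #<= [set: K] ->
  card_lt A [set: K] -> card_lt B [set: K] -> card_lt (A `|` B) [set: K].
Proof.
move=> TK ltA ltB; rewrite -bigcup2inE; apply: card_lt_bigcup => //.
  by apply: card_lt_finite; exact: finite_II.
by move=> [|[|i]].
Qed.

End SmallSets.

(** * Integer ranks on countable groups, and their ratios *)

Lemma rankP (T : Type) (F : nat -> set T) :
  (forall n, F n `<=` F n.+1) -> (forall x, exists n, F n x) ->
  exists r : T -> nat, forall x n, F n x <-> r x <= n.
Proof.
move=> F_incr F_cover.
have F_mono m n x : m <= n -> F m x -> F n x.
  by elim: n => [|n IH]; [case: m|rewrite leq_eqVlt ltnS => /predU1P[->//|mn]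
    /(IH mn)/F_incr].
suff : forall x, exists k, forall n, F n x <-> k <= n.
  by move=> /choice[r]; exists r.
move=> x; have ex : exists n, `[< F n x >].
  by have [n Fn] := F_cover x; exists n; apply/asboolP.
case: (ex_minnP ex) => k /asboolP Fk kmin; exists k => n; split.
  by move=> /asboolP; exact: kmin.
by move=> kn; exact: F_mono Fk.
Qed.

Lemma countable_group_rank (G : groupType) : countable [set: G] ->
  exists r : G -> nat,
    (forall n, finite_set [set x | r x <= n]) /\
    forall x y z n, r x <= n -> r y <= n -> r z <= n -> r (x * y * z)%g <= n.+1.
Proof.
move=> /card_le_injective[c c_inj _].
have c_fin n : finite_set [set x | c x <= n].
  apply: (@card_le_finite _ _ _ `I_n.+1) (finite_II _).
  apply: (@card_le_trans _ _ _ (c @` [set x | c x <= n])); last first.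
    by apply: subset_card_le => _ [x /= xn <-].
  have : c @` [set x | c x <= n] #= [set x | c x <= n].
    by apply: inj_card_eq => x y _ _; exact: c_inj.
  by rewrite card_eq_le => /andP[].
(* Adding the elements of code at most [n] makes the stages exhaust [G]; taking triple products in
   [M] gives the multiplication bound, and the unit keeps the stages increasing. *)
pose T (A : set G) n := A `|` [set x | c x <= n].
pose M (A : set G) := [set (z * t)%g | z in [set (x * y)%g | x in A & y in A] &
                                      t in A].
pose F := fix F n := if n is n'.+1 then M (T (F n') n') else [set 1%g].
have F1 n : F n 1%g.
  elim: n => [//|n F1]; exists (1 * 1)%g; last first.
    by exists 1%g; [left|rewrite !mulg1].
  by exists 1%g; [left|exists 1%g; [left|]].
have T_F n : T (F n) n `<=` F n.+1.
  move=> x Tx; exists (x * 1)%g; last first.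
    by exists 1%g; [left; exact: F1|rewrite !mulg1].
  by exists x => //; exists 1%g; first by left; exact: F1.
have [r rF] : exists r : G -> nat, forall x n, F n x <-> r x <= n.
  apply: rankP => [n x Fx|x]; first by apply: T_F; left.
  by exists (c x).+1; apply: T_F; right => /=.
exists r; split=> [n|x y z n /rF Fx /rF Fy /rF Fz].
  rewrite (_ : [set x | _] = F n); last by apply/predeqP => x; split=> /rF.
  elim: n => [|n IH]; first exact: finite_set1.
  have finT : finite_set (T (F n) n) by rewrite finite_setU.
  by apply: finite_image2 => //; exact: finite_image2.
apply/rF; exists (x * y)%g; last by exists z; [left|].
by exists x; [left|exists y; [left|]].
Qed.

(** For positive arguments, the ratio is within a factor 1 + 1/(N+1) of 1 either way; denominators
    are cleared to stay in the integers. *)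
Definition near_ratio (N n m : nat) : Prop :=
  N.+1 * n <= N.+2 * m /\ N.+1 * m <= N.+2 * n.

(** With a = N+1 the index [4 * N + 3] stands for the factor 1 + 1/(4a), whose square is at most 1 +
    1/a. *)
Lemma near_ratio_split N n m k :
  near_ratio (4 * N + 3) n m -> near_ratio (4 * N + 3) m k -> near_ratio N n k.
Proof.
have half a x y z : 0 < a -> 4 * a * x <= (4 * a).+1 * y ->
    4 * a * y <= (4 * a).+1 * z -> a * x <= a.+1 * z.
  move=> a0 xy yz; rewrite -(leq_pmul2l (m := 16 * a)); last by lia.
  have : 4 * a * (4 * a * x) <= (4 * a).+1 * ((4 * a).+1 * z).
    apply: leq_trans (leq_mul (leqnn _) xy) _.
    by rewrite mulnCA leq_mul2l yz orbT.
  have : 1 * z <= a * z by apply: leq_mul.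
  by nia.
rewrite /near_ratio (_ : (4 * N + 3).+1 = 4 * N.+1); last by lia.
by move=> [nm mn] [mk km]; split; [exact: half nm mk|exact: half km mn].
Qed.

(** n/m <= 1 + 1/m <= 1 + 1/(N+1), and symmetrically. *)
Lemma near_ratio_succ N n m :
  N < n -> N < m -> n <= m.+1 -> m <= n.+1 -> near_ratio N n m.
Proof. by rewrite /near_ratio => *; split; nia. Qed.

(** * The corona of a group with its balanced structure *)

Section BalancedGroup.
Variables (G : groupType) (K : Type).
Hypotheses (cardK : [set: K] #= [set: G]) (regK : regular_cardinal K).

Let GK : [set: G] #<= [set: K].
Proof. by move: cardK; rewrite card_eq_le => /andP[]. Qed.

(** A ball at [a] lies in some FaF, an image of F x F, which is small by regularity. Conversely, [B]
    with the unit added defines a ball at 1 that contains [B]. *)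
Lemma balanced_bounded (B : set G) :
  coarse_bounded (balanced K G) B <-> card_lt B [set: K].
Proof.
split=> [[e [a [[_ [_ [F [ltF F1] <-] eF]] Be]]]|ltB].
  have := card_lt_image2 cardK regK (fun f g => f * a * g)%g ltF ltF.
  apply: card_lt_le; apply: subset_card_le => x /Be/eF [f [g [Ff Fg /= ->]]].
  by exists f => //; exists g.
pose F := B `|` [set 1%g].
have ltF : card_lt F [set: K].
  by apply: card_ltU => //; apply: card_lt_finite.
have F1 : F 1%g by right.
exists (balanced_entourage F), 1%g; split; last first.
  by move=> x Bx; exists x, 1%g; split=> //; [left|rewrite /= !mulg1].
split.
  by move=> [x y] /= xy; exists 1%g, 1%g; split=> //=; rewrite mul1g mulg1.
by exists (balanced_entourage F) => //; exists F.
Qed.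

(** Bounded sets being the small ones, injectivity of [s] makes it proper. Closing [F] under
    inverses lets the applications undo a multiplication. *)
Lemma balanced_contains_copy (V : nat -> G -> G -> Prop) (s : K -> G) :
  (forall N x, V N x x) ->
  (forall N x y, V N x y -> V N y x) ->
  (forall N, exists M, forall x y z, V M x y -> V M y z -> V N x z) ->
  (forall F N, card_lt F [set: K] ->
    (forall f, F f -> F f^-1%g) ->
    exists2 B, card_lt B [set: K] &
      forall x f g, ~ B x -> F f -> F g -> V N x (f * x * g)%g) ->
  (forall a b, V 0 (s a) (s b) -> a = b) ->
  contains_copy (corona (balanced K G)) (uniform_ultra K).
Proof.
move=> V_refl V_sym V_split V_slow s_discrete.
apply: (contains_copy_uniform V_refl V_sym V_split _ _ s_discrete).
  move=> e N [_ [_ [F [ltF F1] <-] eF]].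
  pose F' := F `|` (fun x => x^-1)%g @` F.
  have ltF' : card_lt F' [set: K].
    apply: card_ltU => //; apply: card_lt_le ltF; exact: card_image_le.
  have F'V f : F' f -> F' f^-1%g.
    by case=> [Ff|[g Fg <-]]; [right; exists f|left; rewrite invgK].
  have [B ltB BV] := V_slow F' N ltF' F'V.
  exists B; first exact/balanced_bounded.
  by move=> x y nBx /eF[f [g [/= Ff Fg ->]]]; apply: BV => //; left.
move=> B /balanced_bounded ltB.
have s_inj : injective s by move=> a b sab; apply: s_discrete; rewrite sab.
apply: (card_lt_inj s_inj); apply: card_lt_le ltB.
by apply: subset_card_le => _ [a Ba <-].
Qed.

Lemma corona_copy_countable : countable [set: K] ->
  contains_copy (corona (balanced K G)) (uniform_ultra K).
Proof.
move=> countK; have [infK _] := regK.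
have countG : countable [set: G] by apply: card_le_trans countK.
have [r [r_fin r_mul]] := countable_group_rank countG.
have ltP (T : Type) (A : set T) : card_lt A [set: K] <-> finite_set A.
  split=> [[AK nKA]|]; last exact: card_lt_finite.
  apply: contrapT => /infiniteP natA; apply: nKA.
  exact: card_le_trans natA.
have r_bound (A : set G) : finite_set A -> exists m, forall x, A x -> r x <= m.
  move=> /finite_seqP[t ->]; exists (\max_(x <- t) r x) => x /= xt.
  exact: leq_bigmax_seq.
have /choice[t tP] : forall n, exists x, n < r x.
  move=> n; apply: contrapT => nx.
  have : finite_set [set: G].
    apply: sub_finite_set (r_fin n) => x _ /=; rewrite leqNgt.
    by apply/negP => nrx; apply: nx; exists x.
  by move=> /ltP; case; move: cardK; rewrite card_eq_le => /andP[].
pose s := fix s n := if n is n'.+1 then t (2 * r (s n')) else t 0.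
have s_incr i j : i < j -> 2 * r (s i) < r (s j).
  elim: j => // j IH; rewrite ltnS leq_eqVlt => /predU1P[->|/IH ij].
    exact: tP.
  apply: ltn_trans (tP _); apply: leq_trans ij _.
  by rewrite leq_pmull.
have [h h_inj _] := card_le_injective countK.
apply: (@balanced_contains_copy 
  (fun N x y => near_ratio N (r x) (r y)) (s \o h)).
- by move=> N x; split; lia.
- by move=> N x y [].
- by move=> N; exists (4 * N + 3) => x y z; exact: near_ratio_split.
- move=> F N /ltP/r_bound[m mF] FV.
  (* The margin [N.+1] over [m] makes [r x] dominate [m]; undoing the multiplication then shows that
     the rank of the product also exceeds [N]. *)
  exists [set x | r x <= m + N.+1]; first exact/ltP.
  have r_step x f g : F f -> F g -> r (f * x * g)%g <= (maxn m (r x)).+1.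
    by move=> Ff Fg; apply: r_mul; rewrite leq_max ?leqnn ?orbT // mF.
  move=> x f g /negP; rewrite -ltnNge => xN Ff Fg.
  have le1 := r_step x f g Ff Fg.
  have := r_step (f * x * g)%g _ _ (FV f Ff) (FV g Fg).
  rewrite !mulgA mulVg mul1g -mulgA mulgV mulg1 => le2.
  by apply: near_ratio_succ; lia.
(* At index 0 a factor of at most 2 is allowed, and [s_incr] exceeds it. *)
- move=> a b /= [ab ba]; apply: h_inj.
  by have [/s_incr|/s_incr|//] := ltngtP (h a) (h b); lia.
Qed.

Lemma corona_copy_uncountable : ~ countable [set: K] ->
  contains_copy (corona (balanced K G)) (uniform_ultra K).
Proof.
move=> ncountK; have [infK _] := regK.
have [R woR [ltR cofR]] := regular_initial_order regK.
have [c c_inj _] := card_le_injective GK.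
have nat_lt : card_lt [set: nat] [set: K].
  by split; [apply/infiniteP; exact: infK|exact: ncountK].
(* Stage [n] holds the products of 2^n factors among the unit and the elements before [a]. *)
pose W := fix W a n : set G := if n is n'.+1
  then [set (x * y)%g | x in W a n' & y in W a n']
  else [set x | ~~ R a (c x)] `|` [set 1%g].
pose H a := \bigcup_n W a n.
have W1 a n : W a n 1%g.
  elim: n => [|n W1]; first by right.
  by exists 1%g => //; exists 1%g => //; rewrite mulg1.
have W_mono a m n : m <= n -> W a m `<=` W a n.
  elim: n => [|n IH]; first by case: m => // _ x.
  rewrite leq_eqVlt ltnS => /predU1P[->//|/IH mn] x /mn Wx.
  by exists x => //; exists 1%g => //; rewrite mulg1.
have HM a x y : H a x -> H a y -> H a (x * y)%g.
  move=> [m _ Wx] [n _ Wy]; exists (maxn m n).+1 => //.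
  by exists x; [apply: W_mono Wx|exists y => //; apply: W_mono Wy]; lia.
have H_mono a b : R a b -> H a `<=` H b.
  move=> Rab x [n _ Wx]; exists n => //; elim: n x Wx => [x [/= nRa|->]|n IH x].
  - by left; apply: contra nRa; exact: (well_order_trans woR Rab).
  - by right.
  - by move=> [y /IH Wy [z /IH Wz <-]]; exists y => //; exists z.
(* Uncountability enters here: [H a] is a union of countably many small sets. *)
have H_small a : card_lt (H a) [set: K].
  apply: card_lt_bigcup => // n _.
  elim: n => [|n IH]; last exact: card_lt_image2.
  apply: card_ltU => //; last exact: card_lt_finite.
  by apply: (card_lt_inj c_inj); apply/ltR; exists a => _ [x /= nR <-].
have H_bound (F : set G) : card_lt F [set: K] -> exists a, F `<=` H a.
  move=> ltF; have /ltR[a aP] : card_lt (c @` F) [set: K].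
    by apply: card_lt_le ltF; exact: card_image_le.
  by exists a => x Fx; exists 0 => //; left; apply: aP; exists x.
have /choice[f fP] : forall x, exists a, H a x /\ forall b, H b x -> R a b.
  move=> x.
  have [a aP] := H_bound [set x] (card_lt_finite regK (finite_set1 x)).
  have [|b Hb bmin] := well_order_least woR (P := [set b | H b x]).
    by exists a; exact: aP.
  by exists b.
(* [H a] is too small to be all of [G], and any element outside of it has its [f]-value beyond
   [a]. *)
have f_cofinal : cofinal_set R (range f).
  move=> a; have [x nHx] : exists x, ~ H a x.
    apply: contrapT => nx; have [_] := H_small a; apply.
    have -> : H a = [set: G].
      apply/predeqP => x; split=> // _.
      by apply: contrapT => nHx; apply: nx; exists x.
    by move: cardK; rewrite card_eq_le => /andP[].
  exists (f x); first by exists x.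
  have [//|Rfx] := well_order_total woR a (f x).
  by exfalso; apply: nHx; apply: H_mono Rfx _ _; have [] := fP x.
have /card_le_injective[j j_inj jP] : [set: K] #<= range f.
  by have := cofR _ f_cofinal; rewrite card_eq_le => /andP[].
have /choice[s sP] : forall k, exists x, f x = j k.
  by move=> k; have [x _ fx] := jP k; exists x.
(* The uniformity is given by a single equivalence relation, so the index is irrelevant. *)
apply: (@balanced_contains_copy (fun _ x y => f x = f y) s) => //.
- by move=> N; exists 0 => x y z ->.
- move=> F _ ltF FV; have [b Fb] := H_bound F ltF.
  exists (H b) => // x g h nHx Fg Fh.
  (* Outside of [H b] the submonoid of index [f y] contains [H b], hence [u] and [v], besides [y]
     itself. *)
  have le_f y u v : ~ H b y -> F u -> F v -> R (f (u * y * v)%g) (f y).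
    move=> nHy Fu Fv; have [Hy _] := fP y; have [_] := fP (u * y * v)%g; apply.
    have Rb : R b (f y).
      have [//|Rf] := well_order_total woR b (f y); case: nHy.
      exact: H_mono Rf _ Hy.
    by apply: (HM); [apply: (HM) => //|]; apply: (H_mono _ _ Rb); exact: Fb.
  (* The reverse inequality comes from multiplying back. As [H b] is only a submonoid, the symmetry
     of [F] is what keeps the product outside of it. *)
  have xE : (g^-1 * (g * x * h) * h^-1 = x)%g.
    by rewrite !mulgA mulVg mul1g -mulgA mulgV mulg1.
  apply: (well_order_anti woR); last exact: le_f.
  rewrite -{1}xE; apply: le_f; [|exact: FV..] => Hgx; apply: nHx.
  by rewrite -xE; apply: (HM); [apply: (HM) => //|]; apply: Fb; exact: FV.
- by move=> a b; rewrite !sP => /j_inj.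
Qed.

End BalancedGroup.

Theorem theorem2 (G : groupType) (K : Type)
    (infG : infinite_set [set: G])
    (cardK : [set: K] #= [set: G])
    (regK : regular_cardinal K) :
  contains_copy (corona (balanced K G)) (uniform_ultra K).
Proof.
have [countK|ncountK] := pselect (countable [set: K]).
  exact: corona_copy_countable.
exact: corona_copy_uncountable.
Qed.
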